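(* Let $\mathbb{F}$ be a field, let $m,n,d$ be positive integers, let $P(\lambda)\in\mathbb{F}[\lambda]^{m\times n}_d$, and let $r$ be an integer with $0<r\le\min\{m,n\}$. Then $P(\lambda)$ has normal rank $r$, degree exactly $d$, and has no finite or infinite eigenvalues (the infinite eigenvalues being taken with respect to $d$) if and only if $P(\lambda)$ can be factorized as $P(\lambda)=L(\lambda)R(\lambda)$ with $L(\lambda)\in\mathbb{F}[\lambda]^{m\times r}$ and $R(\lambda)\in\mathbb{F}[\lambda]^{r\times n}$, where the columns of $L(\lambda)$ form a minimal basis (of the rational subspace they span), the rows of $R(\lambda)$ form a minimal basis (of the rational subspace they span), and $$\deg(L_{*i})+\deg(R_{i*})=d\quad\text{for } i=1,\dots,r.$$
   Context: $\mathbb{F}[\lambda]^{m\times n}_d$ denotes the set of $m\times n$ polynomial matrices over $\mathbb{F}$ of degree at most $d$; the degree of a polynomial vector or matrix is the maximum degree of its entries, and the zero polynomial has degree $-\infty$. $L_{*i}$ denotes the $i$th column of $L$ and $R_{i*}$ the $i$th row of $R$. The normal rank of a polynomial matrix is its rank over the field of rational functions $\mathbb{F}(\lambda)$. A rational subspace is a subspace of $\mathbb{F}(\lambda)^k$; a minimal basis of it is a basis consisting of polynomial vectors whose sum of degrees is minimal among all bases consisting of polynomial vectors. Invariant polynomials of $P$ are the nonzero diagonal entries $e_1|e_2|\cdots|e_r$ (monic, each dividing the next) of its Smith form, i.e. $P=U\,\mathrm{diag}(e_1,\dots,e_r,0)\,V$ with $U,V$ unimodular (square polynomial with nonzero constant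 determinant). A finite eigenvalue of $P$ is a root in the algebraic closure $\overline{\mathbb{F}}$ of some invariant polynomial. For $P\in\mathbb{F}[\lambda]^{m\times n}_d$, $P$ has an eigenvalue at $\infty$ (with respect to $d$) if $0$ is a finite eigenvalue of $\lambda^dP(1/\lambda)$. *)

(* Defs.v *)
From HB Require Import structures.
From mathcomp Require Import all_boot all_order all_algebra.
Set Implicit Arguments. Unset Strict Implicit. Unset Printing Implicit Defensive.
Import GRing.Theory.
Local Open Scope ring_scope.

Section PolyMx.
Variable F : fieldType.
Local Notation pF := {poly F}.
Local Notation fracF := {fraction pF}.

Definition fracmx m n (P : 'M[pF]_(m, n)) : 'M[fracF]_(m, n) :=
  map_mx (fun p => tofrac p) P.

Definition normal_rank m n (P : 'M[pF]_(m, n)) : nat := \rank (fracmx P).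

Definition deg_le m n (d : nat) (P : 'M[pF]_(m, n)) : Prop :=
  forall i j, (size (P i j) <= d.+1)%N.

Definition mxdeg m n (P : 'M[pF]_(m, n)) : nat :=
  \max_(i < m) \max_(j < n) (size (P i j)).-1.

(* P has degree exactly d (the zero matrix has degree -oo) *)
Definition deg_exact m n (d : nat) (P : 'M[pF]_(m, n)) : Prop :=
  P != 0 /\ mxdeg P = d.

(* degree of the j-th column / i-th row (meaningful for nonzero vectors) *)
Definition coldeg m n (L : 'M[pF]_(m, n)) (j : 'I_n) : nat :=
  \max_(i < m) (size (L i j)).-1.
Definition rowdeg m n (R : 'M[pF]_(m, n)) (i : 'I_m) : nat :=
  \max_(j < n) (size (R i j)).-1.

Definition unimodular n (U : 'M[pF]_n) : Prop := size (\det U) = 1%N.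

Definition diag_seq m n (e : seq pF) : 'M[pF]_(m, n) :=
  \matrix_(i < m, j < n) if (i : nat) == j then e`_i else 0.

Definition smith_form m n (P : 'M[pF]_(m, n)) (U : 'M[pF]_m) (V : 'M[pF]_n)
    (e : seq pF) : Prop :=
  [/\ unimodular U, unimodular V, (size e <= minn m n)%N &
   [/\ all (fun p => p \is monic) e,
      (forall i, (i.+1 < size e)%N -> e`_i %| e`_i.+1)
    & P = U *m diag_seq m n e *m V]].

Definition fin_eig (K : closedFieldType) (f : {rmorphism F -> K})
    m n (P : 'M[pF]_(m, n)) (x : K) : Prop :=
  exists U V e, smith_form P U V e /\
    exists2 i, (i < size e)%N & root (map_poly f e`_i) x.

(* no finite eigenvalue in the algebraic closure *)
Definition no_fin_eig m n (P : 'M[pF]_(m, n)) : Prop :=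
  forall (K : closedFieldType) (f : {rmorphism F -> K}) (x : K), ~ fin_eig f P x.

Definition fin_eigF m n (P : 'M[pF]_(m, n)) (x : F) : Prop :=
  exists U V e, smith_form P U V e /\
    exists2 i, (i < size e)%N & root e`_i x.

(* reversal lambda^d P(1/lambda) *)
Definition revd (d : nat) (p : pF) : pF := \poly_(i < d.+1) p`_(d - i).
Definition rev_mx m n (d : nat) (P : 'M[pF]_(m, n)) : 'M[pF]_(m, n) :=
  map_mx (revd d) P.

Definition inf_eig m n (d : nat) (P : 'M[pF]_(m, n)) : Prop :=
  fin_eigF (rev_mx d P) 0.

Definition col_minimal_basis m k (L : 'M[pF]_(m, k)) : Prop :=
  row_free (fracmx L)^T /\
  forall L' : 'M[pF]_(m, k),
    row_free (fracmx L')^T -> ((fracmx L')^T == (fracmx L)^T)%MS ->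
    (\sum_(j < k) coldeg L j <= \sum_(j < k) coldeg L' j)%N.

Definition row_minimal_basis k n (R : 'M[pF]_(k, n)) : Prop :=
  row_free (fracmx R) /\
  forall R' : 'M[pF]_(k, n),
    row_free (fracmx R') -> (fracmx R' == fracmx R)%MS ->
    (\sum_(i < k) rowdeg R i <= \sum_(i < k) rowdeg R' i)%N.

End PolyMx.

(* Main.v *)
(** A matrix R with full row rank is a minimal basis of its row space if and
    only if it is right invertible over F[x] and its matrix of leading row
    coefficients has full row rank: if either condition fails, some row can be
    exchanged for a polynomial row of smaller degree, and if both hold, degrees
    are predictable, i.e. deg (v R) = max_j (deg v_j + deg R_j).

    By the Smith form, P has normal rank r and no finite eigenvalue if and only
    if P = A B with A left invertible and B right invertible of inner dimension
    r.  The column space of A has a minimal basis L, and then P = L R with R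
    right invertible.  Writing l_i for the degree of the i-th column of L,
    predictable degrees give deg R_i <= d - l_i, and the coefficient of x^d in P
    is (leading coefficients of L) (coefficients of R_i of degree d - l_i).
    The absence of infinite eigenvalues says that this coefficient has rank r,
    so deg R_i = d - l_i and R is a minimal basis.  Conversely such a
    factorization makes the coefficient of x^d a product of full-rank factors.

    That a nonconstant invariant polynomial yields an eigenvalue needs an
    algebraically closed extension of an arbitrary field F; it is an ultraproduct
    of algebraic closures of the finitely generated (hence countable) subfields
    of F. *)
Require Import Defs.
From HB Require Import structures.
From mathcomp Require Import all_boot all_order all_algebra.
From mathcomp Require Import perm all_field boolp classical_sets filter zify.
Import GRing.Theory.
Local Open Scope ring_scope.

Set Implicit Arguments.
Unset Strict Implicit.
Unset Printing Implicit Defensive.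

(** * Countability of the subfield generated by a finite list *)

Section GeneratedSubfield.
Variables (F : fieldType) (s : seq F).

(** Terms in the elements of [s], built from 1, subtraction and division, reach the whole generated
    subfield. Encoding them as trees over [nat] makes that subfield countable. *)
Fixpoint field_term_eval (t : GenTree.tree nat) : F :=
  match t with
  | GenTree.Leaf i => s`_i
  | GenTree.Node 0 _ => 1
  | GenTree.Node 1 [:: a; b] => field_term_eval a - field_term_eval b
  | GenTree.Node _ [:: a; b] => field_term_eval a / field_term_eval b
  | _ => 0
  end.

Definition in_generated : pred F := fun x => `[< exists t, field_term_eval t = x >].

Lemma generated_divring_closed : divring_closed in_generated.
Proof.
split=> [|x y|x y].
- by apply/asboolP; exists (GenTree.Node 0 [::]).
- move=> /asboolP[t <-] /asboolP[u <-]; apply/asboolP.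
  by exists (GenTree.Node 1 [:: t; u]).
move=> /asboolP[t <-] /asboolP[u <-]; apply/asboolP.
by exists (GenTree.Node 2 [:: t; u]).
Qed.

HB.instance Definition _ :=
  GRing.isDivringClosed.Build F in_generated generated_divring_closed.

Definition generated := {x : F | in_generated x}.

HB.instance Definition _ := SubChoice.on generated.
HB.instance Definition _ := [SubChoice_isSubComUnitRing of generated by <:].
HB.instance Definition _ := [SubComUnitRing_isSubIntegralDomain of generated by <:].
HB.instance Definition _ := [SubIntegralDomain_isSubField of generated by <:].

Definition generated_code (x : generated) : GenTree.tree nat :=
  projT1 (cid (asboolW (valP x))).

Lemma generated_codeK : pcancel generated_code (fun t => insub (field_term_eval t)).
Proof.
by move=> x; rewrite /generated_code; case: cid => t /= ->; rewrite valK.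
Qed.

HB.instance Definition _ := PCanIsCountable generated_codeK.
HB.instance Definition _ := CountRing.Field.on generated.

Lemma mem_generated x : x \in s -> in_generated x.
Proof.
by move=> xs; apply/asboolP; exists (GenTree.Leaf (index x s)); rewrite /= nth_index.
Qed.

End GeneratedSubfield.

(** * An algebraically closed extension of an arbitrary field, as an ultraproduct *)

Section Closure.
Variable F : fieldType.

Definition seq_closure (s : seq F) : closedFieldType :=
  projT1 (countable_algebraic_closure (generated s : countFieldType)).

Definition seq_embed (s : seq F) : {rmorphism generated s -> seq_closure s} :=
  projT1 (projT2 (countable_algebraic_closure (generated s : countFieldType))).

Definition seq_prod := forall s : seq F, seq_closure s.

HB.instance Definition _ := gen_eqMixin seq_prod.
HB.instance Definition _ := gen_choiceMixin seq_prod.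

Definition sp_zero : seq_prod := fun=> 0.
Definition sp_one : seq_prod := fun=> 1.
Definition sp_opp (a : seq_prod) : seq_prod := fun s => - a s.
Definition sp_add (a b : seq_prod) : seq_prod := fun s => a s + b s.
Definition sp_mul (a b : seq_prod) : seq_prod := fun s => a s * b s.

Lemma sp_addA : associative sp_add.
Proof. by move=> a b c; apply: functional_extensionality_dep => s; exact: addrA. Qed.
Lemma sp_addC : commutative sp_add.
Proof. by move=> a b; apply: functional_extensionality_dep => s; exact: addrC. Qed.
Lemma sp_add0 : left_id sp_zero sp_add.
Proof. by move=> a; apply: functional_extensionality_dep => s; exact: add0r. Qed.
Lemma sp_addN : left_inverse sp_zero sp_opp sp_add.
Proof. by move=> a; apply: functional_extensionality_dep => s; exact: addNr. Qed.
HB.instance Definition _ :=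
  GRing.isZmodule.Build seq_prod sp_addA sp_addC sp_add0 sp_addN.
Lemma sp_mulA : associative sp_mul.
Proof. by move=> a b c; apply: functional_extensionality_dep => s; exact: mulrA. Qed.
Lemma sp_mulC : commutative sp_mul.
Proof. by move=> a b; apply: functional_extensionality_dep => s; exact: mulrC. Qed.
Lemma sp_mul1 : left_id sp_one sp_mul.
Proof. by move=> a; apply: functional_extensionality_dep => s; exact: mul1r. Qed.
Lemma sp_mulDl : left_distributive sp_mul +%R.
Proof. by move=> a b c; apply: functional_extensionality_dep => s; exact: mulrDl. Qed.
Lemma sp_one_neq0 : sp_one != 0.
Proof. by apply/eqP => /(congr1 (fun a => a [::]))/eqP; rewrite (negbTE (oner_neq0 _)). Qed.
HB.instance Definition _ :=
  GRing.Zmodule_isComNzRing.Build seq_prod sp_mulA sp_mulC sp_mul1 sp_mulDl sp_one_neq0.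

Lemma spE (s : seq F) : ((0 : seq_prod) s = 0) * ((1 : seq_prod) s = 1) *
  (forall a b : seq_prod, (a + b) s = a s + b s) *
  (forall a : seq_prod, (- a) s = - a s) *
  (forall a b : seq_prod, (a * b) s = a s * b s).
Proof. by []. Qed.

Lemma sp_exp (a : seq_prod) n s : (a ^+ n) s = a s ^+ n.
Proof. by elim: n => [|n IHn] //; rewrite !exprS spE IHn. Qed.

Lemma sp_sum n (a : 'I_n -> seq_prod) s : (\sum_i a i) s = \sum_i a i s.
Proof. by apply: (big_morph (fun a : seq_prod => a s)). Qed.

(** An ultrafilter finer than this filter makes any finitely many elements of [F] lie in almost
    every list [s], hence in almost every generated subfield. *)
Definition containing_filter : set_system (seq F) :=
  fun A => exists t : seq F, forall s, {subset t <= s} -> A s.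

Lemma containing_filter_proper : ProperFilter containing_filter.
Proof.
split; first by case=> t /(_ t); apply.
split; first by exists [::].
- move=> A B [t At] [u Bu]; exists (t ++ u) => s sub; split.
    by apply: At => x xt; apply: sub; rewrite mem_cat xt.
  by apply: Bu => x xu; apply: sub; rewrite mem_cat xu orbT.
by move=> A B AB [t At]; exists t => s /At /AB.
Qed.

Definition seq_ultrafilter : set_system (seq F) :=
  projT1 (cid (ultraFilterLemma containing_filter_proper)).

Lemma seq_ultrafilterP : UltraFilter seq_ultrafilter.
Proof. by rewrite /seq_ultrafilter; case: cid => G []. Qed.
#[local] Existing Instance seq_ultrafilterP.

Lemma seq_ultrafilter_mem (x : F) : seq_ultrafilter [set s : seq F | x \in s]%classic.
Proof.
rewrite /seq_ultrafilter; case: cid => G [_ /= sub]; apply: sub.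
by exists [:: x] => s; apply; rewrite inE.
Qed.

Definition null_ideal : pred seq_prod :=
  fun a => `[< seq_ultrafilter [set s : seq F | a s = 0]%classic >].

Lemma null_idealP : idealr_closed null_ideal.
Proof.
split; first by apply/asboolP; apply: filterS filterT.
  apply/negP => /asboolP /filter_ex[s] /= /eqP.
  by rewrite spE (negbTE (oner_neq0 _)).
move=> a u v /asboolP u0 /asboolP v0; apply/asboolP.
apply: filterS (filterI u0 v0) => s [/= us vs].
by rewrite !spE us vs mulr0 addr0.
Qed.
HB.instance Definition _ := isIdealr.Build seq_prod null_ideal null_idealP.

Definition null_idealr : idealr seq_prod := null_ideal.

Definition ultraproduct := {ideal_quot null_idealr}.
HB.instance Definition _ := GRing.ComNzRing.on ultraproduct.

Definition up_class (a : seq_prod) : ultraproduct := \pi_{ideal_quot null_idealr}%qT a.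

Lemma up_class_eq a b :
  up_class a = up_class b <-> seq_ultrafilter [set s : seq F | a s = b s]%classic.
Proof.
have -> : seq_ultrafilter [set s : seq F | a s = b s]%classic =
          seq_ultrafilter [set s : seq F | (a - b) s = 0]%classic.
  congr (seq_ultrafilter _); apply/seteqP; split => s /= /eqP.
    by rewrite !spE -subr_eq0 => /eqP.
  by rewrite !spE subr_eq0 => /eqP.
rewrite /up_class; split.
  by move/eqP; rewrite -Quotient.idealrBE => /asboolP.
by move=> h; apply/eqP; rewrite -Quotient.idealrBE; apply/asboolP.
Qed.

Lemma up_class_zmod_morphism : zmod_morphism up_class.
Proof. by move=> a b; rewrite /up_class rmorphB. Qed.
Lemma up_class_monoid_morphism : monoid_morphism up_class.
Proof. by split=> [|a b]; rewrite /up_class ?rmorph1 ?rmorphM. Qed.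
HB.instance Definition _ :=
  GRing.isZmodMorphism.Build seq_prod ultraproduct up_class up_class_zmod_morphism.
HB.instance Definition _ :=
  GRing.isMonoidMorphism.Build seq_prod ultraproduct up_class up_class_monoid_morphism.

Definition up_inv (x : ultraproduct) : ultraproduct :=
  if x == 0 then 0 else up_class (fun s => (repr x s)^-1).

(** The zero set of a representative or its complement is in the ultrafilter. The former would give
    [x = 0]; on the latter the coordinatewise inverse works. *)
Lemma up_mulVf x : x != 0 -> up_inv x * x = 1.
Proof.
move=> x0; rewrite /up_inv (negbTE x0).
have xE : x = up_class (repr x) by rewrite /up_class reprK.
rewrite [X in _ * X]xE -rmorphM -(rmorph1 up_class); apply/up_class_eq.
have [h|h] := @in_ultra_setVsetC _ _ [set s : seq F | repr x s = 0]%classic seq_ultrafilterP.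
  case/eqP: x0; rewrite xE -(rmorph0 up_class); apply/up_class_eq.
  by apply: filterS h.
by apply: filterS h => s /= /eqP xs; rewrite !spE mulVf.
Qed.

Lemma up_inv0 : up_inv 0 = 0. Proof. by rewrite /up_inv eqxx. Qed.

HB.instance Definition _ := GRing.ComNzRing_isField.Build ultraproduct up_mulVf up_inv0.

(** Representatives of the coefficients define a monic equation in each closed factor. Roots chosen
    coordinatewise form a root in the quotient. *)
Lemma up_closed : GRing.closed_field_axiom ultraproduct.
Proof.
move=> n P n_gt0; pose Q i := repr (P i).
have ex s : exists x : seq_closure s, x ^+ n = \sum_(i < n) Q i s * x ^+ i.
  exact: (@solve_monicpoly (seq_closure s) n (fun i => Q i s) n_gt0).
pose a : seq_prod := fun s => projT1 (cid (ex s)).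
exists (up_class a); rewrite -rmorphXn.
rewrite (eq_bigr (fun i : 'I_n => up_class (Q i * a ^+ i))); last first.
  by move=> i _; rewrite rmorphM rmorphXn /= {2}/up_class reprK.
rewrite -rmorph_sum; congr up_class; apply: functional_extensionality_dep => s.
have -> : (a ^+ n) s = \sum_(i < n) Q i s * a s ^+ i.
  by rewrite sp_exp /a; case: cid.
by rewrite sp_sum; apply: eq_bigr => i _; rewrite spE sp_exp.
Qed.
HB.instance Definition _ := Field_isAlgClosed.Build ultraproduct up_closed.

(* Off the subfield generated by [s] the value is junk; any finite set of
   elements of [F] avoids this on a set of the ultrafilter. *)
Definition seq_embed_total (x : F) : seq_prod :=
  fun s => if insub x is Some y then seq_embed s y else 0.

Lemma seq_embed_totalE (s : seq F) (y : generated s) :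
  seq_embed_total (val y) s = seq_embed s y.
Proof. by rewrite /seq_embed_total valK. Qed.

Definition field_to_up (x : F) : ultraproduct := up_class (seq_embed_total x).

Lemma seq_embed_totalB s (u v : generated s) :
  seq_embed_total (val u - val v) s =
  seq_embed_total (val u) s - seq_embed_total (val v) s.
Proof.
have -> : seq_embed_total (val u - val v) s = seq_embed s (u - v).
  exact: (seq_embed_totalE (u - v)).
by rewrite !seq_embed_totalE; exact: rmorphB.
Qed.

Lemma seq_embed_totalM s (u v : generated s) :
  seq_embed_total (val u * val v) s =
  seq_embed_total (val u) s * seq_embed_total (val v) s.
Proof.
have -> : seq_embed_total (val u * val v) s = seq_embed s (u * v).
  exact: (seq_embed_totalE (u * v)).
by rewrite !seq_embed_totalE; exact: rmorphM.
Qed.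

Lemma field_to_up_zmod_morphism : zmod_morphism field_to_up.
Proof.
move=> x y; rewrite /field_to_up -rmorphB; apply/up_class_eq.
apply: filterS (filterI (seq_ultrafilter_mem x) (seq_ultrafilter_mem y)).
move=> s [/mem_generated xs /mem_generated ys].
exact: (@seq_embed_totalB s (exist _ x xs) (exist _ y ys)).
Qed.

Lemma field_to_up_monoid_morphism : monoid_morphism field_to_up.
Proof.
split=> [|x y].
  rewrite /field_to_up -(rmorph1 up_class); apply/up_class_eq.
  apply: filterS filterT => s _.
  exact: (etrans (@seq_embed_totalE s 1) (rmorph1 _)).
rewrite /field_to_up -rmorphM; apply/up_class_eq.
apply: filterS (filterI (seq_ultrafilter_mem x) (seq_ultrafilter_mem y)).
move=> s [/mem_generated xs /mem_generated ys].
exact: (@seq_embed_totalM s (exist _ x xs) (exist _ y ys)).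
Qed.

HB.instance Definition _ :=
  GRing.isZmodMorphism.Build F ultraproduct field_to_up field_to_up_zmod_morphism.
HB.instance Definition _ :=
  GRing.isMonoidMorphism.Build F ultraproduct field_to_up field_to_up_monoid_morphism.

Lemma closed_extension_exists :
  exists K : closedFieldType, inhabited {rmorphism F -> K}.
Proof. by exists ultraproduct; constructor; exact: field_to_up. Qed.

End Closure.

(** * Existence of the Smith form over F[x] *)

Section Smith.
Variable F : fieldType.
Local Notation pF := {poly F}.

Lemma unimodularE n (U : 'M[pF]_n) : unimodular U <-> U \in unitmx.
Proof.
rewrite /unimodular unitmxE poly_unitE; split=> [h|/andP[/eqP ->]//].
have /size_poly1P[c c0 ->] : size (\det U) == 1%N by rewrite h.
by rewrite size_polyC c0 coefC eqxx unitfE.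
Qed.

Definition unimod_equiv m n (P Q : 'M[pF]_(m, n)) :=
  exists U V, [/\ U \in unitmx, V \in unitmx & Q = U *m P *m V].

Lemma unimod_equiv_refl m n (P : 'M[pF]_(m, n)) : unimod_equiv P P.
Proof. by exists 1%:M, 1%:M; rewrite !unitmx1 mul1mx mulmx1. Qed.

Lemma unimod_equivM m n (P Q : 'M[pF]_(m, n)) A B :
  A \in unitmx -> B \in unitmx -> unimod_equiv P Q -> unimod_equiv P (A *m Q *m B).
Proof.
move=> uA uB [U [V [uU uV ->]]]; exists (A *m U), (V *m B).
by rewrite !unitmx_mul uA uB uU uV !mulmxA.
Qed.

Lemma unimod_equiv_row m n (P Q : 'M[pF]_(m, n)) (i j : 'I_m) c : i != j ->
  unimod_equiv P Q ->
  unimod_equiv P (\matrix_(k, l) (Q k l + (k == j)%:R * (c * Q i l))).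
Proof.
move=> ij /(@unimod_equivM _ _ _ _ (1%:M + c *: delta_mx j i) 1%:M).
have uA : 1%:M + c *: delta_mx j i \in unitmx.
  apply: (@mulmx1_unit _ _ _ (1%:M - c *: delta_mx j i) _).1.
  rewrite mulmxDl mul1mx mulmxBr mulmx1 -scalemxAl -scalemxAr mul_delta_mx_0 ?(eq_sym j) //.
  by rewrite !scaler0 subr0 subrK.
move=> /(_ uA (unitmx1 _ _)); congr unimod_equiv.
apply/matrixP=> k l; rewrite mulmx1 mulmxDl mul1mx -scalemxAl !mxE; congr (_ + _).
rewrite (bigD1 i) //= big1 => [|h hi]; last by rewrite mxE (negbTE hi) andbF mul0r.
by rewrite !mxE eqxx andbT addr0 mulrCA.
Qed.

Lemma unimod_equiv_tr m n (P Q : 'M[pF]_(m, n)) :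
  unimod_equiv P Q -> unimod_equiv P^T Q^T.
Proof.
by case=> U [V [uU uV ->]]; exists V^T, U^T; rewrite !unitmx_tr uU uV !trmx_mul mulmxA.
Qed.

Lemma unimod_equiv_xrow m n (P Q : 'M[pF]_(m, n)) i j :
  unimod_equiv P Q -> unimod_equiv P (xrow i j Q).
Proof.
move=> /(@unimod_equivM _ _ _ _ (tperm_mx i j) 1%:M).
by rewrite xrowE mulmx1; apply; rewrite ?unitmx1 // unitmx_perm.
Qed.

(* [P] is equivalent to no matrix with a nonzero entry of size less than [s]: an
   entry attaining [s] divides its row and its column, since a nonzero remainder
   would be such an entry. *)
Definition min_pivot m n (P : 'M[pF]_(m, n)) (s : nat) :=
  forall Q, unimod_equiv P Q -> forall i j, Q i j != 0 -> (s <= size (Q i j))%N.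

Lemma min_pivot_tr m n (P : 'M[pF]_(m, n)) s : min_pivot P s -> min_pivot P^T s.
Proof.
move=> h Q /unimod_equiv_tr; rewrite trmxK => /h hQ i j Q0.
by have := hQ j i; rewrite mxE; apply.
Qed.

Lemma min_pivot_dvd_col m n (P Q : 'M[pF]_(m, n)) i k j :
  unimod_equiv P Q -> Q i j != 0 -> min_pivot P (size (Q i j)) -> Q i j %| Q k j.
Proof.
move=> PQ Q0 hmin; have [->//|ik] := eqVneq k i; apply: contraT => ndvd.
have ik' : i != k by rewrite eq_sym.
have := hmin _ (unimod_equiv_row (- (Q k j %/ Q i j)) ik' PQ) k j.
rewrite mxE eqxx mul1r mulNr [X in X - _](divp_eq (Q k j) (Q i j)) addrC addKr.
by rewrite -/(dvdp _ _) ndvd leqNgt ltn_modp Q0 => /(_ isT).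
Qed.

Lemma min_pivot_dvd_row m n (P Q : 'M[pF]_(m, n)) i k j :
  unimod_equiv P Q -> Q i j != 0 -> min_pivot P (size (Q i j)) -> Q i j %| Q i k.
Proof.
move=> /unimod_equiv_tr PQ Q0 /min_pivot_tr hmin.
by have := @min_pivot_dvd_col _ _ _ _ j k i PQ; rewrite !mxE; apply.
Qed.

Lemma unimod_equiv_min_entry m n (P : 'M[pF]_(m, n)) : P != 0 ->
  exists Q i j, [/\ unimod_equiv P Q, Q i j != 0 & min_pivot P (size (Q i j))].
Proof.
move=> P0.
pose A s := `[< exists Q i j, [/\ unimod_equiv P Q, Q i j != 0 & size (Q i j) = s] >].
have exA : exists s, A s.
  have /matrix0Pn[i [j Pij]] := P0; exists (size (P i j)); apply/asboolP.
  by exists P, i, j; split=> //; exact: unimod_equiv_refl.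
case: (ex_minnP exA) => s /asboolP[Q [i [j [PQ Q0 <-]]]] smin.
exists Q, i, j; split=> // R PR k l R0; apply: smin; apply/asboolP.
by exists R, k, l.
Qed.

(** A nonzero entry of least size among all equivalent matrices divides its row and its column, so
    both can be cleared once it is moved to the corner. *)
Lemma unimod_equiv_pivot m n (P : 'M[pF]_(1 + m, 1 + n)) : P != 0 ->
  exists (g : pF) (Z : 'M[pF]_(m, n)), g != 0 /\ unimod_equiv P (block_mx g%:M 0 0 (g *: Z)).
Proof.
move=> /unimod_equiv_min_entry[Q0 [i [j [PQ0 Q0ij hmin]]]].
pose Q : 'M_(1 + m, 1 + n) := xcol 0 j (xrow 0 i Q0).
pose g : pF := Q0 i j.
have Q00 : Q 0 0 = g by rewrite !mxE !tpermL.
have PQ : unimod_equiv P Q.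
  have /unimod_equiv_tr/(unimod_equiv_xrow 0 j)/unimod_equiv_tr := unimod_equiv_xrow 0 i PQ0.
  by rewrite tr_xrow !trmxK.
have g_min : min_pivot P (size (Q 0 0)) by rewrite Q00.
have g0 : Q 0 0 != 0 by rewrite Q00.
clearbody Q g.
have dvd_col k : g %| Q k 0 by rewrite -Q00; exact: min_pivot_dvd_col PQ _ _.
have dvd_row k : g %| Q 0 k by rewrite -Q00; exact: min_pivot_dvd_row PQ _ _.
have divK (x : pF) : g %| x -> g * (x %/ g) = x by move=> gx; rewrite mulrC divpK.
pose u := map_mx (fun x => x %/ g) (ursubmx Q).
pose v := map_mx (fun x => x %/ g) (dlsubmx Q).
have QE : Q = block_mx g%:M (g *: u) (g *: v) (drsubmx Q).
  rewrite -{1}[Q]submxK; congr block_mx; apply/matrixP => a b; rewrite !mxE ?ord1.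
  - by rewrite !lshift0 Q00.
  - by rewrite divK // lshift0 dvd_row.
  by rewrite divK // lshift0 dvd_col.
pose Z := drsubmx Q - g *: (v *m u).
have PB : unimod_equiv P (block_mx g%:M 0 0 Z).
  have := @unimod_equivM _ _ _ _ (block_mx 1%:M 0 (- v) 1%:M)
    (block_mx 1%:M (- u) 0 1%:M) _ _ PQ.
  rewrite !unitmxE det_lblock det_ublock !det1 !mulr1 unitr1 => /(_ isT isT).
  rewrite QE !mulmx_block !(mulmx0, mul0mx, mul1mx, mulmx1, addr0, add0r).
  rewrite !mulNmx !mulmxN !mul_mx_scalar !mul_scalar_mx !addNr !mul0mx oppr0 add0r.
  by rewrite -scalemxAr [- _ + _]addrC.
clearbody Z.
pose R : 'M_(1 + m, 1 + n) := block_mx g%:M 0 0 Z.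
exists g, (map_mx (fun x => x %/ g) Z); split; first by rewrite -Q00.
suff -> : g *: map_mx (fun x => x %/ g) Z = Z by [].
apply/matrixP => a b; rewrite !mxE divK //.
have ne : rshift 1 a != lshift m 0 :> 'I_(1 + m) by [].
(* Adding row [a] of the lower block to the pivot row keeps [g] in the corner and puts [Z a b] in
   its row, so minimality forces [g] to divide [Z a b]. *)
pose S : 'M_(1 + m, 1 + n) :=
  \matrix_(k, l) (R k l + (k == lshift m 0)%:R * (1 * R (rshift 1 a) l)).
have PS : unimod_equiv P S := unimod_equiv_row 1 ne PB.
have S0 : S (lshift m 0) (lshift n 0) = g.
  by rewrite mxE eqxx !mul1r /R block_mxEul block_mxEdl !mxE eqxx addr0.
have := @min_pivot_dvd_row _ _ _ _ (lshift m 0) (rshift 1 b) (lshift n 0) PS.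
rewrite S0 -Q00 => /(_ g0 g_min).
by rewrite Q00 mxE eqxx !mul1r /R block_mxEur block_mxEdr !mxE add0r.
Qed.

Lemma diag_seq_cons m n (g : pF) e :
  diag_seq (1 + m) (1 + n) (g :: e) = block_mx g%:M 0 0 (diag_seq m n e).
Proof.
rewrite -[LHS]submxK; congr block_mx; apply/matrixP => i j; rewrite !mxE ?ord1 //=.
Qed.

Lemma scale_diag_seq m n (g : pF) e :
  g *: diag_seq m n e = diag_seq m n [seq g * x | x <- e].
Proof.
apply/matrixP => i j; rewrite !mxE; case: eqP => _; last by rewrite mulr0.
have [h|h] := ltnP i (size e); first by rewrite (nth_map 0).
by rewrite !nth_default ?size_map // mulr0.
Qed.

(** Induction on the number of rows: the block left after the pivot is [g *: Z], so the invariants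
    of [Z] get multiplied by [g], which yields the divisibility chain. *)
Lemma smith_form_exists m n (P : 'M[pF]_(m, n)) : exists U V e, smith_form P U V e.
Proof.
have trivial m' n' : exists U V e, smith_form (0 : 'M[pF]_(m', n')) U V e.
  exists 1%:M, 1%:M, [::]; split; try by rewrite /unimodular det1 size_poly1.
    by [].
  split=> //; rewrite mul1mx mulmx1; apply/matrixP => i j.
  by rewrite !mxE nth_nil if_same.
elim: m n P => [|m IHm] n P; first by rewrite [P]flatmx0.
case: n P => [|n] P; first by rewrite [P]thinmx0.
have [->//|P0] := eqVneq P 0.
have [g [Z [g0 PB]]] := @unimod_equiv_pivot m n P P0.
have [U1 [V1 [e [/unimodularE uU1 /unimodularE uV1 e_size [e_monic e_dvd ZE]]]]] := IHm n Z.
have {PB} [U0 [V0 [uU0 uV0 BE]]] := PB.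
(* All diagonal entries are [g] times monic polynomials, so moving the one unit [c] into the right
   factor makes all of them monic. *)
pose c := (lead_coef g)%:P : pF; pose g' := (lead_coef g)^-1 *: g.
have lc0 : lead_coef g != 0 by rewrite lead_coef_eq0.
have uc : c \is a GRing.unit by rewrite poly_unitE size_polyC lc0 coefC eqxx unitfE lc0.
have g'm : g' \is monic by rewrite monicE lead_coefZ mulVf.
have gE : g = c * g' by rewrite mul_polyC scalerA mulfV // scale1r.
pose A : 'M[pF]_(1 + m) := block_mx 1%:M 0 0 U1.
pose B : 'M[pF]_(1 + n) := block_mx 1%:M 0 0 V1.
have uA : A \in unitmx by rewrite unitmxE det_ublock det1 mul1r -unitmxE.
have uB : B \in unitmx by rewrite unitmxE det_ublock det1 mul1r -unitmxE.
exists (invmx U0 *m A), (c *: B *m invmx V0), (g' :: [seq g' * x | x <- e]).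
split.
- by apply/unimodularE; rewrite unitmx_mul unitmx_inv uU0.
- by apply/unimodularE; rewrite unitmx_mul unitmx_inv uV0 andbT unitmxZ.
- by rewrite /= size_map minnSS ltnS.
split.
- rewrite /= g'm all_map; apply: sub_all e_monic => x /= xm.
  by rewrite rpredM.
- case=> [|i]; rewrite /= size_map !ltnS => ie.
    by rewrite (nth_map 0) // dvdp_mulr.
  by rewrite !(nth_map 0) ?dvdp_mul2l ?monic_neq0 ?e_dvd // (leq_trans _ ie).
rewrite (diag_seq_cons m n) -scale_diag_seq.
rewrite -[LHS](mulKmx uU0) -[LHS](mulmxK uV0) -!mulmxA; congr (_ *m _).
rewrite !mulmxA -BE; congr (_ *m _).
rewrite -scalemxAr.
have -> : A *m block_mx g'%:M 0 0 (g' *: diag_seq m n e) *m B =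
  block_mx g'%:M 0 0 (g' *: Z) :> 'M_(1 + m, 1 + n).
  rewrite !mulmx_block !(mulmx0, mul0mx, mul1mx, mulmx1, addr0, add0r).
  by rewrite ZE -scalemxAr -scalemxAl.
by rewrite scale_block_mx !scaler0 scale_scalar_mx scalerA -gE.
Qed.

End Smith.

(** * Normal rank and finite eigenvalues read off the Smith form *)

Section NormalRank.

Lemma mxrank_sandwich (K : fieldType) m n k (A : 'M[K]_(m, k)) A' (D : 'M[K]_k)
    (B : 'M[K]_(k, n)) B' :
  A' *m A = 1%:M -> B *m B' = 1%:M -> \rank (A *m D *m B) = \rank D.
Proof.
move=> AA BB; apply/eqP; rewrite eqn_leq -mulmxA.
rewrite (leq_trans (mxrankM_maxr _ _) (mxrankM_maxl _ _)) /=.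
have {1}-> : D = A' *m (A *m (D *m B)) *m B'.
  by rewrite mulmxA AA mul1mx -mulmxA BB mulmx1.
exact: leq_trans (mxrankM_maxl _ _) (mxrankM_maxr _ _).
Qed.

Lemma diag_mx_full_rank (K : fieldType) k (d : 'rV[K]_k) :
  (\rank (diag_mx d) == k) = [forall i, d 0 i != 0].
Proof.
rewrite -/(row_free _) row_free_unit unitmxE unitfE det_diag.
by apply/prodf_neq0/forallP => h i; have := h i => //; apply.
Qed.

Variable F : fieldType.
Local Notation pF := {poly F}.

Lemma diag_seq_thin m n (e : seq pF) : (size e <= minn m n)%N ->
  diag_seq m n e = pid_mx (size e) *m diag_mx (\row_(i < size e) e`_i) *m pid_mx (size e).
Proof.
rewrite leq_min => /andP[em en]; rewrite -mulmxA mul_diag_mx.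
apply/matrixP => i j; rewrite !mxE.
have [ie|ei] := ltnP i (size e); last first.
  rewrite nth_default ?if_same // big1 // => l _.
  by rewrite !mxE [(i < _)%N]ltnNge ei andbF mul0r.
rewrite (bigD1 (Ordinal ie)) //= big1 => [|l]; last first.
  by rewrite -val_eqE /= eq_sym => /negbTE il; rewrite !mxE il mul0r.
by rewrite !mxE /= ie eqxx mul1r addr0 andbT; case: eqP; rewrite ?mulr1 ?mulr0.
Qed.

(** Dropping the zero block leaves outer factors with polynomial one-sided inverses. These
    identities survive both evaluation at a point and passage to fractions, so ranks are decided by
    the diagonal factor. *)
Lemma smith_form_thin m n (P : 'M[pF]_(m, n)) U V e : smith_form P U V e ->
  exists A A' B B', [/\ A' *m A = 1%:M, B *m B' = 1%:M &
    P = A *m diag_mx (\row_(i < size e) e`_i) *m B].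
Proof.
case=> /unimodularE uU /unimodularE uV e_size [_ _ PE].
have [em en] : (size e <= m)%N /\ (size e <= n)%N by apply/andP; rewrite -leq_min.
exists (U *m pid_mx (size e)), (pid_mx (size e) *m invmx U).
exists (pid_mx (size e) *m V), (invmx V *m pid_mx (size e)); split.
- by rewrite mulmxA mulmxKV // mul_pid_mx !minnn (minn_idPr em) pid_mx_1.
- by rewrite mulmxA mulmxK // mul_pid_mx !minnn (minn_idPr en) pid_mx_1.
by rewrite PE diag_seq_thin // !mulmxA.
Qed.

Lemma fracmxM m n p (A : 'M[pF]_(m, n)) (B : 'M[pF]_(n, p)) :
  fracmx (A *m B) = fracmx A *m fracmx B.
Proof. exact: map_mxM. Qed.

Lemma fracmx1 n : fracmx (1%:M : 'M[pF]_n) = 1%:M.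
Proof. exact: map_mx1. Qed.

Lemma fracmx_inj m n : injective (@fracmx F m n).
Proof.
move=> A B /matrixP AB; apply/matrixP => i j; have := AB i j.
by rewrite !mxE => /eqP; rewrite tofrac_eq => /eqP.
Qed.

Lemma smith_form_neq0 m n (P : 'M[pF]_(m, n)) U V e i :
  smith_form P U V e -> (i < size e)%N -> e`_i != 0.
Proof.
case=> _ _ _ [/allP e_monic _ _] ie.
by rewrite monic_neq0 // e_monic ?mem_nth.
Qed.

Lemma smith_form_normal_rank m n (P : 'M[pF]_(m, n)) U V e :
  smith_form P U V e -> normal_rank P = size e.
Proof.
move=> sf; have [A [A' [B [B' [AA BB ->]]]]] := smith_form_thin sf.
rewrite /normal_rank !fracmxM.
rewrite (@mxrank_sandwich _ _ _ _ _ (fracmx A') _ _ (fracmx B')) -?fracmxM ?AA ?BB ?fracmx1 //.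
rewrite /fracmx map_diag_mx; apply/eqP; rewrite diag_mx_full_rank.
by apply/forallP => i; rewrite !mxE tofrac_eq0 (smith_form_neq0 sf).
Qed.

(** The rank of the evaluated matrix equals that of the evaluated diagonal, which is full exactly
    when no invariant polynomial vanishes at [x]. This applies to every Smith form of [P], so
    testing one suffices. *)
Lemma not_fin_eigFP m n (P : 'M[pF]_(m, n)) x :
  ~ fin_eigF P x <-> \rank (map_mx (horner_eval x) P) = normal_rank P.
Proof.
have rankE U V e : smith_form P U V e ->
    (\rank (map_mx (horner_eval x) P) == normal_rank P) =
    [forall i : 'I_(size e), ~~ root e`_i x].
  move=> sf; rewrite (smith_form_normal_rank sf).
  have [A [A' [B [B' [AA BB ->]]]]] := smith_form_thin sf.
  rewrite !map_mxM (@mxrank_sandwich _ _ _ _ _ (map_mx (horner_eval x) A') _ _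
    (map_mx (horner_eval x) B')) -?map_mxM ?AA ?BB ?map_mx1 //.
  rewrite map_diag_mx diag_mx_full_rank.
  by apply: eq_forallb => i; rewrite !mxE.
split=> [neig|/eqP rk [U [V [e [sf [i ie ri]]]]]]; last first.
  by move: rk; rewrite (rankE _ _ _ sf) => /forallP/(_ (Ordinal ie))/negP.
have [U [V [e sf]]] := smith_form_exists P.
apply/eqP; rewrite (rankE _ _ _ sf); apply/forallP => i; apply/negP => ri.
by apply: neig; exists U, V, e; split=> //; exists i.
Qed.

(** Without eigenvalues the invariant polynomials have no root in a closed extension, so being monic
    they are 1 and the diagonal factor disappears. Conversely, the one-sided inverses force the
    invariant polynomials to be units. *)
Lemma normal_rank_no_fin_eigP m n r (P : 'M[pF]_(m, n)) :
  normal_rank P = r /\ no_fin_eig P <->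
  exists (A : 'M_(m, r)) A' (B : 'M_(r, n)) B',
    [/\ A' *m A = 1%:M, B *m B' = 1%:M & P = A *m B].
Proof.
split=> [[<- neig]|[A [A' [B [B' [AA BB PE]]]]]].
  have [U [V [e sf]]] := smith_form_exists P.
  rewrite (smith_form_normal_rank sf).
  have [A [A' [B [B' [AA BB PE]]]]] := smith_form_thin sf.
  exists A, A', B, B'; split=> //; rewrite {}PE.
  suff -> : diag_mx (\row_(i < size e) e`_i) = 1%:M by rewrite mulmx1.
  rewrite -diag_const_mx; congr diag_mx; apply/rowP => i; rewrite !mxE.
  have [K [f]] := closed_extension_exists F.
  have [_ _ _ [/allP e_monic _ _]] := sf.
  have em : e`_i \is monic by rewrite e_monic ?mem_nth.
  have [|s1] := eqVneq (size e`_i) 1%N.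
    by move/eqP/size_poly1P => [c _ ce]; move: em; rewrite ce monicE lead_coefC => /eqP ->.
  have /closed_rootP[x rx] : size (map_poly f e`_i) != 1%N by rewrite size_map_poly.
  by case: (neig K f x); exists U, V, e; split=> //; exists i.
have rk : normal_rank P = r.
  rewrite /normal_rank PE -[fracmx _](congr1 (fun X => fracmx (X *m B)) (mulmx1 A)).
  rewrite !fracmxM fracmx1.
  rewrite (@mxrank_sandwich _ _ _ _ _ (fracmx A') _ _ (fracmx B')) ?mxrank1 //.
    by rewrite -fracmxM AA fracmx1.
  by rewrite -fracmxM BB fracmx1.
split=> // K f x [U [V [e [sf [i ie]]]]].
move: (smith_form_normal_rank sf); rewrite {}rk => re; subst r.
have [A1 [_ [B1 [_ [_ _ PE1]]]]] := smith_form_thin sf.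
(* All three factors are square of size [r], so taking determinants exhibits each invariant
   polynomial as a divisor of 1. *)
have : (A' *m A1) *m diag_mx (\row_(i < size e) e`_i) *m (B1 *m B') = 1%:M.
  by rewrite -!mulmxA (mulmxA _ B1) (mulmxA A1) (mulmxA A1) -PE1 PE -mulmxA BB mulmx1.
move/(congr1 determinant); rewrite !det_mulmx det1 det_diag (bigD1 (Ordinal ie)) //=.
rewrite !mxE /= mulrCA -mulrA => E.
have /size_poly1P[c c0 ->] : size e`_i == 1%N.
  have : e`_i \is a GRing.unit.
    by apply/unitrPr; eexists; exact: E.
  by rewrite poly_unitE => /andP[].
by rewrite map_polyC rootC fmorph_eq0 (negbTE c0).
Qed.

End NormalRank.

(** * Minimal bases: leading coefficients, right inverses and degrees *)

Section RowBases.
Variable F : fieldType.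
Local Notation pF := {poly F}.

Definition row_lead k n (R : 'M[pF]_(k, n)) : 'M[F]_(k, n) :=
  \matrix_(i, j) (R i j)`_(rowdeg R i).

Lemma rowdeg_leP k n (R : 'M[pF]_(k, n)) i d :
  reflect (forall j, (size (R i j) <= d.+1)%N) (rowdeg R i <= d)%N.
Proof.
apply: (iffP idP) => [/bigmax_leqP h j|h]; last apply/bigmax_leqP => j _.
  by have := h j isT; case: size.
by have := h j; case: size.
Qed.

Lemma size_rowdeg k n (R : 'M[pF]_(k, n)) i j : (size (R i j) <= (rowdeg R i).+1)%N.
Proof. exact: (rowdeg_leP _ _ _ (leqnn _)). Qed.

Lemma eq_rowdeg k k' n (R : 'M[pF]_(k, n)) (R' : 'M[pF]_(k', n)) i i' :
  row i R = row i' R' -> rowdeg R i = rowdeg R' i'.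
Proof.
by move=> /rowP h; apply: eq_bigr => j _; have := h j; rewrite !mxE => ->.
Qed.

Lemma right_inverse_row_free k n (R : 'M[pF]_(k, n)) Y :
  R *m Y = 1%:M -> row_free (fracmx R).
Proof. by move=> RY; apply/row_freeP; exists (fracmx Y); rewrite -fracmxM RY fracmx1. Qed.

Lemma row_free_mulmx_eq0 k n (R : 'M[pF]_(k, n)) l (v : 'M[pF]_(l, k)) :
  row_free (fracmx R) -> v *m R = 0 -> v = 0.
Proof.
move=> fR vR; apply: (@fracmx_inj F); apply: (row_free_inj fR).
by rewrite -!fracmxM vR mul0mx.
Qed.

(** Steinitz exchange over F(x): row [j] of [R] can be recovered from [w] because [v 0 j] is
    nonzero. The factor [p] clears denominators, so that [v] may be taken polynomial. *)
Lemma row_basis_exchange k n (R R' : 'M[pF]_(k, n)) (p : pF)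
    (w : 'rV_n) (v : 'rV_k) j :
  row_free (fracmx R) -> p != 0 -> v 0 j != 0 -> p *: w = v *m R ->
  row j R' = w -> (forall i, i != j -> row i R' = row i R) ->
  row_free (fracmx R') /\ (fracmx R' == fracmx R)%MS.
Proof.
move=> fR p0 vj pw Rj Ri.
have rowF (S : 'M[pF]_(k, n)) i : row i (fracmx S) = fracmx (row i S).
  by rewrite /fracmx map_row.
have scF (q : pF) (u : 'rV[pF]_n) : fracmx (q *: u) = tofrac q *: fracmx u.
  by apply/rowP => a; rewrite !mxE tofracM.
have fpw : tofrac p *: fracmx w = \sum_i tofrac (v 0 i) *: row i (fracmx R).
  by rewrite -scF pw fracmxM mulmx_sum_row; apply: eq_bigr => i _; rewrite mxE.
have le1 : (fracmx R' <= fracmx R)%MS.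
  apply/row_subP => i; have [->|ij] := eqVneq i j; last by rewrite rowF Ri // -rowF row_sub.
  rewrite rowF Rj -(eqmx_scale _ (_ : tofrac p != 0)) ?tofrac_eq0 // fpw.
  by apply: summx_sub => l _; rewrite scalemx_sub // row_sub.
have le2 : (fracmx R <= fracmx R')%MS.
  apply/row_subP => i; have [->|ij] := eqVneq i j; last by rewrite rowF -Ri // -rowF row_sub.
  rewrite -(eqmx_scale _ (_ : tofrac (v 0 j) != 0)) ?tofrac_eq0 //.
  have -> : tofrac (v 0 j) *: row j (fracmx R) = tofrac p *: fracmx w -
      \sum_(l | l != j) tofrac (v 0 l) *: row l (fracmx R).
    by rewrite fpw (bigD1 j) //= addrK.
  rewrite addmx_sub //; first by rewrite scalemx_sub // -Rj -rowF row_sub.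
  rewrite eqmx_opp; apply: summx_sub => l lj.
  by rewrite scalemx_sub // rowF -Ri // -rowF row_sub.
split; last by rewrite le1.
by rewrite /row_free eqn_leq rank_leq_row -{1}(eqP fR) mxrankS.
Qed.

Lemma row_minimal_basis_exchange k n (R : 'M[pF]_(k, n)) (p : pF)
    (w : 'rV_n) (v : 'rV_k) j :
  row_minimal_basis R -> p != 0 -> v 0 j != 0 -> p *: w = v *m R ->
  exists l, (rowdeg R j < size (w 0%R l))%N.
Proof.
move=> [fR minR] p0 vj pw; apply/existsP; apply: contraT.
rewrite negb_exists => /forallP wl.
have {}wl l : (size (w 0%R l) <= rowdeg R j)%N by rewrite leqNgt.
pose R' : 'M[pF]_(k, n) := \matrix_i if i == j then w else row i R.
have Rj : row j R' = w by rewrite rowK eqxx.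
have Ri i : i != j -> row i R' = row i R by move=> ij; rewrite rowK (negbTE ij).
have [fR' eqR'] := row_basis_exchange fR p0 vj pw Rj Ri.
have := minR _ fR' eqR'; rewrite (bigD1 j) //= [X in (_ <= X)%N](bigD1 j) //=.
rewrite (eq_bigr (fun i => rowdeg R i) (fun i ij => eq_rowdeg (Ri i ij))).
rewrite leq_add2r leqNgt => /negP[].
(* A zero row also has [rowdeg] 0, so degree 0 cannot drop further. Here the size bound makes [w]
   zero, which contradicts the independence of the rows. *)
have [d0|d_gt0] := posnP (rowdeg R j).
  have w0 : w = 0.
    apply/rowP => l; rewrite mxE; apply/eqP; rewrite -size_poly_leq0.
    by have := wl l; rewrite d0.
  have v0 : v = 0 by apply: row_free_mulmx_eq0 fR _; rewrite -pw w0 scaler0.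
  by rewrite v0 mxE eqxx in vj.
apply: leq_ltn_trans (_ : (rowdeg R j).-1 < _)%N; last by rewrite prednK.
by apply/rowdeg_leP => l; move/rowP/(_ l): Rj; rewrite mxE => ->; rewrite prednK.
Qed.

Lemma coefM_max (p q : pF) a b : (size p <= a.+1)%N -> (size q <= b.+1)%N ->
  (p * q)`_(a + b) = p`_a * q`_b.
Proof.
move=> pa qb; have ab : (a < (a + b).+1)%N by rewrite ltnS leq_addr.
rewrite coefM (bigD1 (Ordinal ab)) //= addKn big1 ?addr0 // => i.
rewrite -val_eqE /= neq_ltn => /orP[ia|ai].
  by rewrite [q`__]nth_default ?mulr0 // (leq_trans qb) // ltn_subRL ltn_add2r.
by rewrite nth_default ?mul0r // (leq_trans pa).
Qed.

(** Let [N] be the largest degree of a product of [v 0 i] and row [i]. The coefficient of x^N in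
    [v *m R] is a nonzero constant combination of the rows of [row_lead R], so it cannot cancel. *)
Lemma row_lead_predictable_degree k n (R : 'M[pF]_(k, n)) (v : 'rV[pF]_k) :
  row_free (row_lead R) -> forall j, v 0 j != 0 ->
  exists l, (size (v 0%R j) + rowdeg R j <= size ((v *m R)%R 0%R l))%N.
Proof.
move=> fR j vj.
have [j0 v0 jmax] := @arg_maxnP _ j (fun i => v 0 i != 0)
  (fun i => size (v 0%R i) + rowdeg R i)%N vj.
have s_gt0 : (0 < size (v 0%R j0) + rowdeg R j0)%N by rewrite addn_gt0 size_poly_gt0 v0.
pose N := (size (v 0%R j0) + rowdeg R j0).-1.
have vN i : v 0 i != 0 -> (size (v 0%R i) + rowdeg R i <= N.+1)%N.
  by move=> vi; rewrite /N prednK //; exact: jmax.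
pose c : 'rV[F]_k := \row_i if v 0 i == 0 then 0 else (v 0 i)`_(N - rowdeg R i).
have cE l : ((v *m R) 0 l)`_N = (c *m row_lead R) 0 l.
  rewrite !mxE coef_sum; apply: eq_bigr => i _; rewrite !mxE.
  have [->|vi] := eqVneq (v 0 i) 0; first by rewrite mul0r coef0 mul0r.
  have := vN i vi => h.
  have dN : (rowdeg R i <= N)%N.
    by rewrite -ltnS (leq_trans _ h) // -add1n leq_add2r size_poly_gt0.
  rewrite -{1}(subnK dN) coefM_max ?size_rowdeg //.
  by rewrite -subSn // leq_subRL ?(leq_trans dN) // addnC.
have c0 : c != 0.
  apply/rV0Pn; exists j0; rewrite mxE (negbTE v0) /N.
  by rewrite -subn1 subnAC addnK subn1 -lead_coefE lead_coef_eq0.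
have : c *m row_lead R != 0.
  by apply: contraNneq c0 => cR; apply/eqP/(row_free_inj fR); rewrite cR mul0mx.
case/rV0Pn => l; rewrite -cE => lN; exists l.
rewrite (leq_trans (vN j vj)) // ltnNge; apply: contra lN => sl.
by rewrite nth_default.
Qed.

(** A constant relation among the leading rows, padded by powers of x to a common degree, gives a
    combination of the rows of [R] whose top coefficient cancels. It could replace a row of largest
    degree among those involved. *)
Lemma row_minimal_basis_lead_free k n (R : 'M[pF]_(k, n)) :
  row_minimal_basis R -> row_free (row_lead R).
Proof.
move=> minR; rewrite -kermx_eq0; apply: contraT => /rowV0Pn[c /sub_kermxP cR /rV0Pn[j cj]].
have [j0 c0 jmax] := @arg_maxnP _ j (fun i => c 0 i != 0) (rowdeg R) cj.
have {}jmax i : c 0 i != 0 -> (rowdeg R i <= rowdeg R j0)%N := jmax i.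
pose v : 'rV[pF]_k := \row_i (c 0 i *: 'X^(rowdeg R j0 - rowdeg R i)).
have v0 : v 0 j0 != 0 by rewrite mxE subnn expr0 scaler_eq0 oner_eq0 orbF.
have [l] := row_minimal_basis_exchange minR (oner_neq0 pF) v0 (scale1r _).
rewrite ltnNge => /negP[]; apply/leq_sizeP => h; rewrite leq_eqVlt mxE coef_sum.
case/predU1P => [<-|jh].
  transitivity ((c *m row_lead R) 0 l); last by rewrite cR mxE.
  rewrite mxE; apply: eq_bigr => i _; rewrite !mxE -scalerAl coefZ.
  have [->|ci] := eqVneq (c 0 i) 0; first by rewrite !mul0r.
  by rewrite coefXnM ltnNge leq_subr /= subKn // jmax.
apply: big1 => i _; rewrite mxE -scalerAl coefZ.
have [->|ci] := eqVneq (c 0 i) 0; first by rewrite mul0r.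
rewrite coefXnM; case: ifP => _; first by rewrite mulr0.
rewrite nth_default ?mulr0 // (leq_trans (size_rowdeg _ _ _)) //.
by rewrite ltn_subRL subnK // jmax.
Qed.

(** A nonconstant invariant polynomial [f] divides some combination of the rows of [R] whose
    coefficients it does not all divide. Reducing the coefficients modulo [f] and then dividing by
    [f] gives a row of smaller degree to exchange. *)
Lemma row_minimal_basis_right_inverse k n (R : 'M[pF]_(k, n)) :
  row_minimal_basis R -> exists Y, R *m Y = 1%:M.
Proof.
move=> minR; have [fR _] := minR.
have [U [V [e sf]]] := smith_form_exists R.
have ek : k = size e by rewrite -(smith_form_normal_rank sf); apply/esym/eqP.
have [A [A' [B [B' [AA BB RE]]]]] := smith_form_thin sf.
subst k; have AA' : A *m A' = 1%:M by exact: mulmx1C.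
have [/forallP e1|] := boolP [forall i : 'I_(size e), size e`_i == 1%N].
  exists (B' *m A'); rewrite RE mulmxA -[_ *m B *m B']mulmxA BB mulmx1.
  have -> : diag_mx (\row_(i < size e) e`_i) = 1%:M.
    rewrite -diag_const_mx; congr diag_mx; apply/rowP => i; rewrite !mxE.
    have [_ _ _ [/allP e_monic _ _]] := sf.
    have : e`_i \is monic by rewrite e_monic ?mem_nth.
    by have /size_poly1P[c _ ->] := e1 i; rewrite monicE lead_coefC => /eqP ->.
  by rewrite mulmx1 AA'.
rewrite negb_forall => /existsP[i si].
have e0 := smith_form_neq0 sf (ltn_ord i); set f := e`_i in si e0.
pose v := row i A'.
have vR : v *m R = f *: row i B.
  rewrite /v -row_mul RE -mulmxA mulmxA AA mul1mx.
  by apply/rowP => l; rewrite mul_diag_mx !mxE.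
pose q := map_mx (fun x => x %/ f) v; pose s := map_mx (fun x => x %% f) v.
have vE : v = f *: q + s.
  by apply/rowP => l; rewrite !mxE [X in X = _](divp_eq _ f) mulrC.
have sR : f *: (row i B - q *m R) = s *m R.
  by rewrite scalerBr -vR vE mulmxDl -scalemxAl addrC addKr.
(* Otherwise [f] would divide row [i] of [A'], hence the diagonal entry 1 of [A' *m A]. *)
have s0 : s != 0.
  apply: contraNneq si => s0.
  have /rowP/(_ i) : v *m A = f *: (q *m A) by rewrite vE s0 addr0 scalemxAl.
  rewrite /v -row_mul AA !mxE eqxx => E.
  have : f \is a GRing.unit by apply/unitrPr; eexists; apply/esym/E.
  by rewrite poly_unitE => /andP[].
have /rV0Pn[j sj] := s0.
have [j0 sj0 jmax] := @arg_maxnP _ j (fun i => s 0 i != 0) (rowdeg R) sj.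
have {}jmax i : s 0 i != 0 -> (rowdeg R i <= rowdeg R j0)%N := jmax i.
have [l] := row_minimal_basis_exchange minR e0 sj0 sR.
set w := row i B - q *m R in sR *; rewrite ltnNge => /negP[].
have [->|w0] := eqVneq (w 0 l) 0; first by rewrite size_poly0.
(* Degrees are compared after multiplying by [f]: entries of [s] have degree below that of [f], and
   the rows involved have degree at most that of row [j0]. *)
rewrite -(leq_add2l (size f).-1) -?subn1 addnBAC ?size_poly_gt0 // subn1 -size_mul //.
have -> : f * w 0 l = (s *m R) 0 l by rewrite -sR [RHS]mxE.
rewrite [(s *m R) 0 l]mxE (leq_trans (size_sum _ _ _)) //; apply/bigmax_leqP => h _.
have [->|sh] := eqVneq (s 0 h) 0; first by rewrite mul0r size_poly0.
rewrite (leq_trans (size_polyMleq _ _)) //.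
have sf_lt : (size (s 0%R h) < size f)%N by rewrite mxE ltn_modp.
have key (a b c x y : nat) : (a < c -> b <= x.+1 -> x <= y -> (a + b).-1 <= c - 1 + y)%N.
  by lia.
exact: key sf_lt (size_rowdeg R h l) (jmax h sh).
Qed.

(** Any competing basis is [T *m R] with [T] polynomial, thanks to the right inverse. Predictable
    degrees bound [rowdeg R j] by [rowdeg R' i] whenever [T i j] is nonzero, and a permutation
    matches the rows. *)
Lemma row_minimal_basis_intro k n (R : 'M[pF]_(k, n)) Y :
  R *m Y = 1%:M -> row_free (row_lead R) -> row_minimal_basis R.
Proof.
move=> RY leadR; split=> [|R' fR' /andP[le1 _]]; first exact: right_inverse_row_free RY.
pose T := R' *m Y.
have R'E : R' = T *m R.
  apply: (@fracmx_inj F); have [X XE] := submxP le1.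
  by rewrite /T !fracmxM XE -2!mulmxA (mulmxA (fracmx R)) -fracmxM RY fracmx1 mul1mx.
have : \det T != 0.
  apply/eqP => T0.
  have /row_freeP[Z] : row_free (fracmx T).
    rewrite /row_free eqn_leq rank_leq_row -{1}(eqP fR') R'E fracmxM mxrankM_maxl.
    by [].
  move/(congr1 determinant); rewrite det_mulmx det1 /fracmx det_map_mx T0 rmorph0 mul0r.
  by move/eqP; rewrite eq_sym oner_eq0.
(* If every permutation met a zero entry of [T], each term of the Leibniz expansion of the
   determinant would vanish. *)
have [|h] := boolP [exists s : 'S_k, [forall i, T i (s i) != 0]]; last first.
  case/eqP; apply: big1 => s _.
  move: h; rewrite negb_exists => /forallP/(_ s); rewrite negb_forall => /existsP[i].
  by rewrite negbK => /eqP Ti; rewrite (bigD1 i) //= Ti mul0r mulr0.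
case/existsP => s /forallP Ts _.
rewrite (reindex_inj (@perm_inj _ s)); apply: leq_sum => i _.
have rT : (row i T) 0 (s i) != 0 by rewrite mxE.
have [l] := row_lead_predictable_degree leadR rT.
rewrite -row_mul -R'E [in X in (_ <= X)%N -> _]mxE => h.
have h' := leq_trans h (size_rowdeg R' i l).
rewrite -ltnS; apply: leq_trans h'.
by rewrite -add1n leq_add2r size_poly_gt0.
Qed.

Lemma row_minimal_basis_exists k n (R : 'M[pF]_(k, n)) : row_free (fracmx R) ->
  exists R' : 'M_(k, n), row_minimal_basis R' /\ (fracmx R' == fracmx R)%MS.
Proof.
move=> fR.
pose A s := `[< exists R' : 'M_(k, n), [/\ row_free (fracmx R'), (fracmx R' == fracmx R)%MS &
  (\sum_i rowdeg R' i)%N = s] >].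
have exA : exists s, A s.
  by exists (\sum_i rowdeg R i)%N; apply/asboolP; exists R; rewrite submx_refl.
case: (ex_minnP exA) => s /asboolP[R' [fR' eqR' <-]] smin.
exists R'; split=> //; split=> // R'' fR'' /eqmxP eqR''; apply: smin; apply/asboolP.
exists R''; split=> //; apply/eqmxP; apply: eqmx_trans eqR'' _; exact/eqmxP.
Qed.

(** The change of basis over F(x) is obtained by multiplying with a polynomial right inverse, so it
    is polynomial in both directions. *)
Lemma same_row_space_unimodular k n (R R' : 'M[pF]_(k, n)) Y Y' :
  R *m Y = 1%:M -> R' *m Y' = 1%:M -> (fracmx R' == fracmx R)%MS ->
  exists T T', [/\ R = T *m R', T' *m T = 1%:M & T *m T' = 1%:M].
Proof.
move=> RY RY' /andP[le1 le2].
have E (A B : 'M[pF]_(k, n)) Z : (fracmx A <= fracmx B)%MS -> B *m Z = 1%:M ->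
    A = (A *m Z) *m B.
  move=> /submxP[X XE] BZ; apply: (@fracmx_inj F).
  by rewrite !fracmxM XE -2!mulmxA (mulmxA (fracmx B)) -fracmxM BZ fracmx1 mul1mx.
have TT' : (R *m Y') *m (R' *m Y) = 1%:M by rewrite mulmxA -E.
by exists (R *m Y'), (R' *m Y); split; rewrite -?E //; exact: mulmx1C.
Qed.

End RowBases.

(** * Reversal and the eigenvalue at infinity *)

Section Reversal.
Variable F : fieldType.
Local Notation pF := {poly F}.

Lemma revdE d (p : pF) : revd d p = \sum_(i < d.+1) p`_i *: 'X^(d - i).
Proof.
rewrite /revd poly_def (reindex_inj rev_ord_inj); apply: eq_bigr => i _ /=.
by rewrite subSS subKn // -ltnS.
Qed.

Lemma revd_is_semilinear d : semilinear (@revd F d).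
Proof.
split=> [c p|p q]; rewrite !revdE.
  by rewrite scaler_sumr; apply: eq_bigr => i _; rewrite coefZ scalerA.
by rewrite -big_split; apply: eq_bigr => i _; rewrite coefD scalerDl.
Qed.
HB.instance Definition _ d :=
  GRing.isSemilinear.Build F pF pF _ (@revd F d) (revd_is_semilinear d).

Lemma revdXn d i : (i <= d)%N -> revd d 'X^i = 'X^(d - i) :> pF.
Proof.
move=> id; rewrite -ltnS in id; rewrite revdE (bigD1 (Ordinal id)) //=.
rewrite coefXn eqxx scale1r big1 ?addr0 // => j; rewrite -val_eqE /= => /negbTE ji.
by rewrite coefXn ji scale0r.
Qed.

Lemma poly_sumXn d (p : pF) : (size p <= d.+1)%N -> p = \sum_(i < d.+1) p`_i *: 'X^i.
Proof.
move=> pd; rewrite -poly_def; apply/polyP => i; rewrite coef_poly.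
by case: ltnP => // di; rewrite nth_default // (leq_trans pd).
Qed.

Lemma revdM a b (p q : pF) : (size p <= a.+1)%N -> (size q <= b.+1)%N ->
  revd (a + b) (p * q) = revd a p * revd b q.
Proof.
move=> pa qb; rewrite {1}(poly_sumXn pa) {1}(poly_sumXn qb) !revdE.
rewrite -revdE !mulr_suml linear_sum; apply: eq_bigr => i _.
rewrite !mulr_sumr linear_sum; apply: eq_bigr => j _.
rewrite -!scalerAl -!scalerAr !linearZ /= -!exprD !scalerA [in LHS]mulrC; congr (_ *: _).
have := ltn_ord i; have := ltn_ord j; rewrite !ltnS => jb ia.
by rewrite revdXn ?leq_add //; congr 'X^_; lia.
Qed.

(** The degree bounds may vary with the inner index [l]; reversal still distributes because each
    pair of bounds adds up to the same [d]. *)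
Lemma rev_mulmx m n k d (L : 'M[pF]_(m, k)) (R : 'M[pF]_(k, n)) (f g : 'I_k -> nat) :
  (forall i l, (size (L i l) <= (f l).+1)%N) ->
  (forall l j, (size (R l j) <= (g l).+1)%N) -> (forall l, (f l + g l)%N = d) ->
  rev_mx d (L *m R) =
  (\matrix_(i, l) revd (f l) (L i l)) *m (\matrix_(l, j) revd (g l) (R l j)).
Proof.
move=> Lf Rg fg; apply/matrixP => i j; rewrite !mxE linear_sum.
by apply: eq_bigr => l _; rewrite !mxE /= -(fg l) revdM.
Qed.

Definition coef_mx m n d (P : 'M[pF]_(m, n)) : 'M[F]_(m, n) := map_mx (coefp d) P.

Lemma coef_mulmx_max m n k d (L : 'M[pF]_(m, k)) (R : 'M[pF]_(k, n)) (f g : 'I_k -> nat) :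
  (forall i l, (size (L i l) <= (f l).+1)%N) ->
  (forall l j, (size (R l j) <= (g l).+1)%N) -> (forall l, (f l + g l)%N = d) ->
  coef_mx d (L *m R) = (\matrix_(i, l) (L i l)`_(f l)) *m (\matrix_(l, j) (R l j)`_(g l)).
Proof.
move=> Lf Rg fg; apply/matrixP => i j; rewrite !mxE /= coef_sum.
by apply: eq_bigr => l _; rewrite !mxE -(fg l) coefM_max.
Qed.

(** The value at 0 of the reversal is the coefficient of x^d. *)
Lemma not_inf_eigP m n d (P : 'M[pF]_(m, n)) :
  ~ inf_eig d P <-> \rank (coef_mx d P) = normal_rank (rev_mx d P).
Proof.
suff <- : map_mx (horner_eval 0) (rev_mx d P) = coef_mx d P by exact: not_fin_eigFP.
by apply/matrixP => i j; rewrite !mxE /horner_eval horner_coef0 coef_poly subn0.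
Qed.

Lemma deg_le_mxdeg m n (P : 'M[pF]_(m, n)) : deg_le (mxdeg P) P.
Proof.
move=> i j; have : ((size (P i j)).-1 <= mxdeg P)%N.
  by rewrite (leq_trans _ (leq_bigmax i)) // (leq_trans _ (leq_bigmax j)).
by case: size.
Qed.

Lemma mxdeg_leP m n (P : 'M[pF]_(m, n)) d : deg_le d P <-> (mxdeg P <= d)%N.
Proof.
split=> [Pd|h i j]; last exact: leq_trans (deg_le_mxdeg P i j) _.
apply/bigmax_leqP => i _; apply/bigmax_leqP => j _; have := Pd i j.
by case: size.
Qed.

(** Reversing [A *m P *m B = 1%:M] turns the right side into a power of x times the identity, of
    normal rank [r], and the left side into a product through [rev_mx d P]. *)
Lemma normal_rank_rev_ge m n r d (P : 'M[pF]_(m, n)) (A : 'M_(r, m)) (B : 'M_(n, r)) :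
  deg_le d P -> A *m P *m B = 1%:M -> (r <= normal_rank (rev_mx d P))%N.
Proof.
move=> Pd APB; set a := mxdeg A; set b := mxdeg B.
have : rev_mx (a + d + b) (A *m P *m B) = rev_mx a A *m rev_mx d P *m rev_mx b B.
  have degM : deg_le (a + d) (A *m P).
    move=> i j; rewrite mxE (leq_trans (size_sum _ _ _)) //; apply/bigmax_leqP => l _.
    rewrite (leq_trans (size_polyMleq _ _)) //.
    have key (s t x y : nat) : (s <= x.+1 -> t <= y.+1 -> (s + t).-1 <= (x + y).+1)%N by lia.
    exact: key (deg_le_mxdeg A i l) (Pd l j).
  rewrite (@rev_mulmx _ _ _ _ _ _ (fun=> a + d)%N (fun=> b)) //; last exact: deg_le_mxdeg.
  congr (_ *m _); last by apply/matrixP => i j; rewrite !mxE.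
  transitivity (rev_mx (a + d) (A *m P)); first by apply/matrixP => i j; rewrite !mxE.
  rewrite (@rev_mulmx _ _ _ _ _ _ (fun=> a)%N (fun=> d)) //; last exact: deg_le_mxdeg.
  by congr (_ *m _); apply/matrixP => i j; rewrite !mxE.
have -> : rev_mx (a + d + b) (A *m P *m B) = ('X^(a + d + b))%:M.
  apply/matrixP => i j; rewrite APB !mxE; case: eqP => _; last by rewrite linear0.
  by rewrite -[1%:R]/('X^0) revdXn // subn0.
move/(congr1 (@normal_rank F r r)); rewrite /normal_rank /fracmx map_scalar_mx.
rewrite -scalemx1 mxrank_scale_nz ?tofrac_eq0 ?expf_neq0 ?polyX_eq0 // mxrank1 => {1}->.
rewrite -[map_mx _ _]/(fracmx (rev_mx a A *m rev_mx d P *m rev_mx b B)).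
by rewrite !fracmxM (leq_trans (mxrankM_maxl _ _)) // mxrankM_maxr.
Qed.

Lemma col_minimal_basis_tr m k (L : 'M[pF]_(m, k)) :
  col_minimal_basis L <-> row_minimal_basis L^T.
Proof.
have trE (A : 'M[pF]_(m, k)) : (fracmx A)^T = fracmx A^T by rewrite /fracmx map_trmx.
have degE (A : 'M[pF]_(m, k)) j : coldeg A j = rowdeg A^T j.
  by apply: eq_bigr => i _; rewrite mxE.
have sumE (A : 'M[pF]_(m, k)) : (\sum_j coldeg A j = \sum_j rowdeg A^T j)%N.
  by apply: eq_bigr => j _; rewrite degE.
split=> -[fL minL]; (split; first by rewrite -?trE // trE) => L' fL' eqL.
  by have := minL L'^T; rewrite trE !sumE !trmxK; apply=> //; rewrite trE.
by rewrite !sumE; apply: minL; rewrite -!trE.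
Qed.

End Reversal.

(** * The two directions of the equivalence, by way of the coefficient of x^d *)

Theorem theorem3p19 (F : fieldType) (m n d r : nat)
    (P : 'M[{poly F}]_(m, n)) :
  (0 < m)%N -> (0 < n)%N -> (0 < d)%N -> deg_le d P ->
  (0 < r)%N -> (r <= minn m n)%N ->
  ((normal_rank P = r /\ deg_exact d P /\ no_fin_eig P /\ ~ inf_eig d P)
   <->
   exists (L : 'M[{poly F}]_(m, r)) (R : 'M[{poly F}]_(r, n)),
     [/\ P = L *m R, col_minimal_basis L, row_minimal_basis R
       & forall i : 'I_r, (coldeg L i + rowdeg R i)%N = d]).
Proof.
move=> m_gt0 n_gt0 d_gt0 Pd r_gt0 r_le; split.
  case=> rkP [_ [neig ninf]].
  have [A [A' [B [B' [AA BB PE]]]]] := (normal_rank_no_fin_eigP r P).1 (conj rkP neig).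
  have AT : A^T *m A'^T = 1%:M by rewrite -trmx_mul AA trmx1.
  (* Work with the transpose: the columns of [A] are replaced by a minimal basis, and the unimodular
     change of basis [T] is absorbed into the right factor. *)
  have [L0 [minL0 eqL0]] := row_minimal_basis_exists (right_inverse_row_free AT).
  have [Y0 LY0] := row_minimal_basis_right_inverse minL0.
  have [T [T' [ATE T'T TT']]] := same_row_space_unimodular AT LY0 eqL0.
  pose R := T^T *m B.
  have PLR : P = L0^T *m R by rewrite PE /R mulmxA -trmx_mul -ATE trmxK.
  have RY : R *m (B' *m T'^T) = 1%:M.
    by rewrite /R -mulmxA (mulmxA B) BB mul1mx -trmx_mul T'T trmx1.
  clearbody R.
  (* Column [j] of [P], transposed, is a combination of the rows of [L0] with coefficients from
     column [j] of [R], so predictable degrees apply. *)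
  have degR l j : R l j != 0 -> (size (R l j) + rowdeg L0 l <= d.+1)%N.
    move=> Rlj; have R0 : (row j R^T) 0 l != 0 by rewrite !mxE.
    have [i] := row_lead_predictable_degree (row_minimal_basis_lead_free minL0) R0.
    have PT : R^T *m L0 = P^T by rewrite PLR trmx_mul trmxK.
    by rewrite -row_mul PT !mxE => h; exact: leq_trans h (Pd i j).
  (* Row [l] of [R] is nonzero by right invertibility. This bound keeps the subtraction in [g] from
     being truncated. *)
  have Ld l : (rowdeg L0 l <= d)%N.
    have /existsP[j Rlj] : [exists j, R l j != 0].
      apply: contraT; rewrite negb_exists => /forallP R0.
      have /matrixP/(_ l l) := RY; rewrite !mxE eqxx big1 => [/eqP|j _].
        by rewrite eq_sym oner_eq0.
      by have := R0 j; rewrite negbK => /eqP ->; rewrite mul0r.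
    rewrite -ltnS; apply: leq_trans (degR l j Rlj).
    by rewrite -add1n leq_add2r size_poly_gt0.
  pose g l := (d - rowdeg L0 l)%N.
  have Rg l j : (size (R l j) <= (g l).+1)%N.
    have [->|Rlj] := eqVneq (R l j) 0; first by rewrite size_poly0.
    rewrite /g -subSn // leq_subRL; last exact: leqW.
    by rewrite addnC; exact: degR.
  have fg l : (rowdeg L0 l + g l)%N = d by rewrite subnKC.
  have Lf i l : (size (L0^T i l) <= (rowdeg L0 l).+1)%N by rewrite mxE size_rowdeg.
  have cP := coef_mulmx_max Lf Rg fg; rewrite -PLR in cP.
  pose C : 'M[F]_(r, n) := \matrix_(l, j) (R l j)`_(g l).
  (* The coefficient of x^d factors through [C], and without an eigenvalue at infinity its rank is
     the normal rank of the reversal, at least [r]. *)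
  have rkC : row_free C.
    rewrite /row_free eqn_leq rank_leq_row.
    apply: leq_trans (_ : (\rank (coef_mx d P) <= _)%N); last by rewrite cP mxrankM_maxr.
    rewrite ((not_inf_eigP d P).1 ninf).
    apply: (normal_rank_rev_ge Pd (A := A') (B := B')).
    by rewrite PE mulmxA AA mul1mx BB.
  (* A full-rank [C] has no zero row, so each bound [g l] is attained. *)
  have Rdeg l : rowdeg R l = g l.
    apply/eqP; rewrite eqn_leq; apply/andP; split; first by apply/rowdeg_leP => j; exact: Rg.
    have /rV0Pn[j] : row l C != 0.
      apply/eqP => Cl; have [Z CZ] := row_freeP rkC.
      have /rowP/(_ l) : row l C *m Z = row l 1%:M by rewrite -row_mul CZ.
      by rewrite Cl mul0mx !mxE eqxx => /eqP; rewrite eq_sym oner_eq0.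
    rewrite !mxE => Rlj; rewrite -ltnS; apply: leq_trans (size_rowdeg R l j).
    by rewrite ltnNge; apply: contra Rlj => s; rewrite nth_default.
  exists L0^T, R; split=> //.
  - by apply/col_minimal_basis_tr; rewrite trmxK.
  - apply: row_minimal_basis_intro RY _.
    suff -> : row_lead R = C by [].
    by apply/matrixP => l j; rewrite !mxE Rdeg.
  - move=> l; rewrite Rdeg -[RHS](fg l); congr (_ + _)%N.
    by apply: eq_bigr => i _; rewrite mxE.
case=> L [R [PLR /col_minimal_basis_tr minL minR degLR]].
have [Y LY] := row_minimal_basis_right_inverse minL.
have [Z RZ] := row_minimal_basis_right_inverse minR.
have LY' : Y^T *m L = 1%:M by rewrite -[L]trmxK -trmx_mul LY trmx1.
have [rkP neig] : normal_rank P = r /\ no_fin_eig P.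
  by apply/normal_rank_no_fin_eigP; exists L, Y^T, R, Z.
have LdegE l : coldeg L l = rowdeg L^T l by apply: eq_bigr => i _; rewrite mxE.
have Lf i l : (size (L i l) <= (coldeg L l).+1)%N.
  by rewrite LdegE (leq_trans _ (size_rowdeg L^T l i)) // mxE.
have cP := coef_mulmx_max Lf (size_rowdeg R) degLR.
have rP := rev_mulmx Lf (size_rowdeg R) degLR.
rewrite -PLR in cP rP.
(* The coefficient of x^d is the product of the leading coefficient matrices of [L] and [R], which
   have a left and a right inverse respectively. *)
have rkc : \rank (coef_mx d P) = r.
  have /row_freeP[R' RR'] := row_minimal_basis_lead_free minR.
  have /row_freeP[L' LL'] := row_minimal_basis_lead_free minL.
  rewrite cP -[X in X *m _]mulmx1 (@mxrank_sandwich _ _ _ _ _ L'^T _ _ R') ?mxrank1 //.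
  rewrite -[X in _ *m X]trmxK -trmx_mul -trmx1 -LL'; congr (_ *m _)^T.
  by apply/matrixP => l i; rewrite !mxE LdegE.
split=> //; split; last split=> //.
  split; first by apply: contraTneq r_gt0 => P0; rewrite -rkc P0 /coef_mx raddf0 mxrank0.
  apply/eqP; rewrite eqn_leq; apply/andP; split; first exact/mxdeg_leP.
  (* A degree below [d] would make the coefficient of x^d zero, whereas its rank is [r > 0]. *)
  rewrite leqNgt; apply: contraTN r_gt0 => h; rewrite -rkc -eqn0Ngt mxrank_eq0.
  apply/eqP/matrixP => i j; rewrite !mxE /= nth_default //.
  exact: leq_trans (deg_le_mxdeg P i j) _.
(* The normal rank of the reversal is at least [r] by the one-sided inverses, and at most [r]
   because the reversed factorization has inner dimension [r]. *)
apply/not_inf_eigP/eqP; rewrite rkc eqn_leq.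
rewrite (normal_rank_rev_ge Pd (A := Y^T) (B := Z)) /=; last first.
  by rewrite PLR mulmxA LY' mul1mx RZ.
by rewrite rP /normal_rank fracmxM (leq_trans (mxrankM_maxl _ _)) // rank_leq_col.
Qed.
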